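(* Let $d\ge2$ and $1\le n\le m$ be integers. For every isometry $V\in \mathrm{U}(\mathcal{H}_{d}^{\otimes n},\mathcal{H}_{d}^{\otimes m})$, there exists a quantum circuit for implementing $V$ using $m-n$ ancilla qudits initialized to $|0\rangle^{\otimes(m-n)}$, such that the number of CINC gates in the circuit is at most $$N(d,n,m)=4d^n\Big(\frac{d^m-1}{d-1}-m\Big)+d^nN_{\mathrm{U}}(d,m).$$
   Context: $N_{\mathrm{U}}(d,m)=2+\sum_{r=3}^{m}\min\{N_{\mathrm{SU}}^{\mathrm{rec}}(r),N_{\mathrm{SU}}(d,r)\}$ (the sum being empty, i.e. $N_{\mathrm U}(d,m)=2$, for $m\le2$), where for $3\le r\le6$ the minimum is taken to be $N_{\mathrm{SU}}^{\mathrm{rec}}(r)$. Here, for $r\ge3$, $N^{\mathrm{rec}}_{\mathrm{SU}}(r)=2^{2k}+3\cdot 2^{k}(r-2^{k}-1)$ with $k=\lfloor\log_2(r-1)\rfloor$; and for $r\ge 7$, $N_{\mathrm{SU}}(d,r)$ equals $16r-48$ if $d=2$, $32r-160$ if $d=3$, and $(32d-40)r-192d+272$ if $d\ge4$. $\mathcal{H}_{d}$ is a $d$-dimensional complex Hilbert space with orthonormal (computational) basis $|0\rangle,\dots,|d-1\rangle$ (a qudit). $\mathrm{U}(\mathcal{H}_{d}^{\otimes n},\mathcal{H}_{d}^{\otimes m})$ is the set of linear operators $V:\mathcal{H}_d^{\otimes n}\to\mathcal{H}_d^{\otimes m}$ with $V^\dagger V=I$. $X_d=|0\rangle\langle d-1|+\sum_{a=0}^{d-2}|a+1\rangle\langle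 a|$. A CINC gate on $m$ qudits is, for some $i\ne j$, the unitary that on a computational basis vector $|x_1\dots x_m\rangle$ applies $X_d$ to the $j$-th tensor factor if $x_i=d-1$ and acts as the identity otherwise. A single-qudit gate is an arbitrary unitary acting nontrivially on one tensor factor only. A circuit implementing $V$ with $m-n$ ancilla qudits is a finite product $U$ of CINC gates and single-qudit gates on $m$ qudits with $U(|0\rangle^{\otimes(m-n)}\otimes|\psi\rangle)=V|\psi\rangle$ for every $|\psi\rangle\in\mathcal{H}_d^{\otimes n}$. *)

(* Defs.v *)
From mathcomp Require Import all_boot all_order all_algebra.
From mathcomp Require Import complex.
From mathcomp Require Import reals.

Set Implicit Arguments.
Unset Strict Implicit.
Unset Printing Implicit Defensive.

Import GRing.Theory Num.Theory.
Local Open Scope ring_scope.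
Local Open Scope complex_scope.
Local Open Scope sesquilinear_scope.

(* Computational basis of the n-fold tensor power of H_d: the basis vector    *)
(* |x_1 ... x_n> is the function sending a tensor factor k to the digit x_k.  *)
Definition basis (d n : nat) := {ffun 'I_n -> 'I_d}.

(* Dimension of the n-fold tensor power of H_d; equal to d ^ n.  Vectors and  *)
(* operators are column vectors and matrices in the computational basis,      *)
(* whose elements are numbered by enum_rank / enum_val.                       *)
Notation qdim d n := #|{: basis d n}|.

Definition isometry_mx (C : numClosedFieldType) (d n m : nat)
    (V : 'M[C]_(qdim d m, qdim d n)) : Prop :=
  V^t* *m V = 1%:M.

(* The vector |0...0>; it is written without an inhabitant of 'I_d. *)
Definition ket0 (C : numClosedFieldType) (d n : nat) : 'cV[C]_(qdim d n) :=
  \col_x ([forall k, (enum_val x : basis d n) k == 0%N :> nat])%:R.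

(* u (x) v, with u on the first p of the m = p + q factors and v on the last  *)
(* q: the coefficient at |x_1 ... x_m> is u_(x_1...x_p) * v_(x_(p+1)...x_m).  *)
Definition tensor (C : numClosedFieldType) (d p q m : nat) (e : (p + q)%N = m)
    (u : 'cV[C]_(qdim d p)) (v : 'cV[C]_(qdim d q)) : 'cV[C]_(qdim d m) :=
  \col_z
    let x : basis d m := enum_val z in
    let xl : basis d p := [ffun k => x (cast_ord e (lshift q k))] in
    let xr : basis d q := [ffun k => x (cast_ord e (rshift p k))] in
    u (enum_rank xl) 0 * v (enum_rank xr) 0.

(* X_d = \sum_a |a + 1 mod d><a|; ordS is the cyclic successor on 'I_d. *)
Definition Xgate (C : numClosedFieldType) (d : nat) : 'M[C]_d :=
  \sum_(a < d) delta_mx (ordS a) a.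

(* The entry <y| I (x) ... (x) u (x) ... (x) I |x>, with u at the factor j. *)
Definition local_entry (C : numClosedFieldType) (d m : nat) (j : 'I_m)
    (u : 'M[C]_d) (y x : basis d m) : C :=
  u (y j) (x j) * ([forall k, (k != j) ==> (y k == x k)])%:R.

Definition local_mx (C : numClosedFieldType) (d m : nat) (j : 'I_m)
    (u : 'M[C]_d) : 'M[C]_(qdim d m) :=
  \matrix_(y, x) local_entry j u (enum_val y) (enum_val x).

(* The column at |x> is X_d applied to the factor j of |x> if x_i = d - 1,    *)
(* and |x> itself otherwise.                                                  *)
Definition cinc_mx (C : numClosedFieldType) (d m : nat) (i j : 'I_m) :
    'M[C]_(qdim d m) :=
  \matrix_(y, x)
    if (enum_val x : basis d m) i == d.-1 :> nat
    then local_entry j (Xgate C d) (enum_val y) (enum_val x)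
    else (y == x)%:R.

Inductive gate (C : numClosedFieldType) (d m : nat) : Type :=
| Cinc (i j : 'I_m) of i != j
| Single (j : 'I_m) (u : 'M[C]_d) of u \is unitarymx.

Definition gate_mx (C : numClosedFieldType) (d m : nat) (g : gate C d m) :
    'M[C]_(qdim d m) :=
  match g with
  | Cinc i j _ => cinc_mx C d i j
  | Single j u _ => local_mx j u
  end.

Definition is_cinc (C : numClosedFieldType) (d m : nat) (g : gate C d m) :
    bool :=
  if g is Cinc _ _ _ then true else false.

(* Gates are listed in the order of the operator product: the last gate of    *)
(* the list acts first.                                                       *)
Definition circuit (C : numClosedFieldType) (d m : nat) := seq (gate C d m).

Definition circuit_mx (C : numClosedFieldType) (d m : nat)
    (c : circuit C d m) : 'M[C]_(qdim d m) :=
  foldr (fun g U => gate_mx g *m U) 1%:M c.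

Definition cinc_count (C : numClosedFieldType) (d m : nat)
    (c : circuit C d m) : nat :=
  count (@is_cinc C d m) c.

(* The m - n ancillas, all in state |0>, are the first m - n of the m qudits. *)
Definition implements (C : numClosedFieldType) (d n m : nat) (hnm : (n <= m)%N)
    (c : circuit C d m) (V : 'M[C]_(qdim d m, qdim d n)) : Prop :=
  forall psi : 'cV[C]_(qdim d n),
    circuit_mx c *m tensor (subnK hnm) (ket0 C d (m - n)) psi = V *m psi.

Local Open Scope nat_scope.

(* In the ranges of d and r where these counts are used, no subtraction below *)
(* truncates and every division is exact.                                     *)

Definition NSUrec (r : nat) : nat :=
  let k := trunc_log 2 (r - 1) in
  2 ^ (2 * k) + 3 * 2 ^ k * (r - 2 ^ k - 1).

(* For d >= 4 this is (32 d - 40) r - 192 d + 272; adding 272 first keeps the *)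
(* natural-number subtraction from truncating.                                *)
Definition NSU (d r : nat) : nat :=
  if d == 2 then 16 * r - 48
  else if d == 3 then 32 * r - 160
  else (32 * d - 40) * r + 272 - 192 * d.

Definition NU (d m : nat) : nat :=
  2 + \sum_(3 <= r < m.+1)
        (if r <= 6 then NSUrec r else minn (NSUrec r) (NSU d r)).

Definition Ncinc (d n m : nat) : nat :=
  4 * d ^ n * ((d ^ m - 1) %/ (d - 1) - m) + d ^ n * NU d m.

(* Main.v *)
(** Complete the columns of V one at a time by reflections
    H = 1 - (1 - l) w w^* / |w|^2 of the whole register: if U already sends the
    first columns of the ancilla embedding to those of V, the reflection that
    takes the next image to the next column of V fixes the previous ones, since
    they are orthogonal to w.  Each of the d^n reflections is W^* P W, where W
    sends w to a multiple of a fixed basis vector |z...z> and P is a phase on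
    that vector.

    The state preparation W follows Bullock, O'Leary and Brennen: qudit by qudit,
    it uses (d^m - 1)/(d - 1) - m operators with a single control, and m
    uncontrolled ones.  Each controlled operator costs only one CINC, because any
    vector of H_d is sent to a multiple of |z> by some conjugate of X_d.  The
    phase P costs at most 2 (2^m - 1 - m) CINCs by a naive recursion over
    commutators, which the CINCs saved in W and W^* pay for. *)

Require Import Defs.
From mathcomp Require Import all_boot all_order all_algebra all_fingroup.
From mathcomp Require Import complex.
From mathcomp Require Import reals.
From mathcomp Require Import zify ring.

Set Implicit Arguments.
Unset Strict Implicit.
Unset Printing Implicit Defensive.

Import Order.TTheory GRing.Theory Num.Theory.
Local Open Scope ring_scope.
Local Open Scope sesquilinear_scope.

(** * Adjoints, unitary matrices and scalars of modulus 1 *)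

Section Adjoint.
Variable C : numClosedFieldType.

Lemma trCmx_mul m n p (A : 'M[C]_(m, n)) (B : 'M_(n, p)) :
  (A *m B)^t* = B^t* *m A^t*.
Proof. by rewrite trmx_mul map_mxM. Qed.

Lemma trCmxK m n (A : 'M[C]_(m, n)) : (A^t*)^t* = A.
Proof. by apply/matrixP => i j; rewrite !mxE conjCK. Qed.

Lemma trCmx1 n : (1%:M : 'M[C]_n)^t* = 1%:M.
Proof. by rewrite trmx1 map_mx1. Qed.

Lemma trCmxZ m n a (A : 'M[C]_(m, n)) : (a *: A)^t* = a^* *: A^t*.
Proof. by apply/matrixP => i j; rewrite !mxE rmorphM. Qed.

Lemma unitarymx1 n : (1%:M : 'M[C]_n) \is unitarymx.
Proof. by apply/unitarymxP; rewrite trCmx1 mulmx1. Qed.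

Lemma unitary_mulVmx n (A : 'M[C]_n) : A \is unitarymx -> A^t* *m A = 1%:M.
Proof. by move=> /unitarymxP/mulmx1C. Qed.

Lemma diag_unitary n (f : 'I_n -> C) :
  (forall a, `|f a| = 1) -> diag_mx (\row_a f a) \is unitarymx.
Proof.
move=> nf; apply/unitarymxP/matrixP => i j; rewrite mxE.
rewrite (bigD1 i) //= big1 => [|k ki]; last first.
  by rewrite !mxE eq_sym (negbTE ki) mul0r.
rewrite !mxE eqxx mulr1n addr0 eq_sym; case: eqP => [->|_].
  by rewrite mulr1n -normCK nf expr1n.
by rewrite mulr0n conjC0 mulr0.
Qed.

Lemma norm1_conjC (x : C) : `|x| = 1 -> x * x^* = 1.
Proof. by move=> nx; rewrite -normCK nx expr1n. Qed.

Lemma norm_rootC1 k (x : C) : (0 < k)%N -> `|x| = 1 -> `|k.-root x| = 1.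
Proof.
move=> k0 nx; apply/eqP; rewrite -(@pexpr_eq1 _ _ k) ?normr_ge0 //.
by rewrite -normrX rootCK // nx.
Qed.

End Adjoint.

(** * Changing one digit of a basis vector *)

Section Basis.
Variables d m : nat.
Implicit Types (x y : basis d m) (j : 'I_m) (a : 'I_d).

Definition upd x j a : basis d m := [ffun k => if k == j then a else x k].

Lemma upd_same x j a : upd x j a j = a.
Proof. by rewrite ffunE eqxx. Qed.

Lemma upd_neq x j a k : k != j -> upd x j a k = x k.
Proof. by rewrite ffunE => /negbTE ->. Qed.

Lemma upd_id x j : upd x j (x j) = x.
Proof. by apply/ffunP => k; rewrite ffunE; case: eqP => [->|]. Qed.

Lemma upd_upd x j a b : upd (upd x j a) j b = upd x j b.
Proof. by apply/ffunP => k; rewrite !ffunE; case: eqP. Qed.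

Lemma updC x i j a b : i != j -> upd (upd x i a) j b = upd (upd x j b) i a.
Proof.
move=> ij; apply/ffunP => k; rewrite !ffunE.
by case: (k =P j) => [->|//]; rewrite eq_sym (negbTE ij).
Qed.

(** Asked of every control predicate: the control must not look at the target qudit [j]. *)
Definition indep (p : pred (basis d m)) j := forall x a, p (upd x j a) = p x.

Lemma indep_eq i j b : i != j -> indep (fun x => x i == b) j.
Proof. by move=> ij x a; rewrite upd_neq. Qed.

End Basis.

(** * Controlled operators with one target qudit *)

Section Controlled.
Variables (C : numClosedFieldType) (d m : nat).
Implicit Types (x y : basis d m) (j : 'I_m) (a : 'I_d) (p : pred (basis d m)).
Implicit Types (u : 'M[C]_d) (v : 'cV[C]_(qdim d m)).

Definition coef v y := v (enum_rank y) 0.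

(** One family covers all gates: [predT] gives the single-qudit gates, a test on one digit gives
    CINC and its variants. *)
Definition ctl_mx p j u : 'M[C]_(qdim d m) :=
  \matrix_(y, x) if p (enum_val x) then local_entry j u (enum_val y) (enum_val x)
                 else (y == x)%:R.

Lemma local_mxE j u : local_mx j u = ctl_mx predT j u.
Proof. by []. Qed.

Lemma cinc_mxE i j :
  cinc_mx C d i j = ctl_mx (fun x => x i == d.-1 :> nat) j (Xgate C d).
Proof. by []. Qed.

Lemma coef_ext v w : (forall y, coef v y = coef w y) -> v = w.
Proof.
move=> h; apply/matrixP => r c.
by rewrite (ord1 c) -[r]enum_valK; apply: h.
Qed.

Lemma mx_coef_ext n (A B : 'M[C]_(qdim d m, n)) :
  (forall (w : 'cV_n) y, coef (A *m w) y = coef (B *m w) y) -> A = B.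
Proof.
move=> h; apply/matrixP => r c.
have /matrixP/(_ r 0) : A *m (delta_mx c 0 : 'cV_n) = B *m delta_mx c 0.
  by apply: coef_ext => y; apply: h.
by rewrite -!colE !mxE.
Qed.

Lemma coef_mul n (A : 'M[C]_(n, qdim d m)) v r :
  (A *m v) r 0 = \sum_(x : basis d m) A r (enum_rank x) * coef v x.
Proof.
rewrite mxE (reindex (@enum_rank (basis d m))) //.
by exists enum_val => x _; [exact: enum_rankK | exact: enum_valK].
Qed.

Lemma coef_ctl p j u v y : indep p j ->
  coef (ctl_mx p j u *m v) y =
    if p y then \sum_a u (y j) a * coef v (upd y j a) else coef v y.
Proof.
move=> ip; rewrite {1}/coef coef_mul.
under eq_bigr => x _ do rewrite mxE !enum_rankK (inj_eq enum_rank_inj).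
case: ifP => py; last first.
  rewrite (bigD1 y) //= py eqxx mul1r big1 ?addr0 // => x xy.
  rewrite /local_entry eq_sym (negbTE xy); case: ifP => px; last by rewrite mul0r.
  case: forallP => [h|_]; last by rewrite mulr0 mul0r.
  have e : x = upd y j (x j).
    apply/ffunP => k; rewrite ffunE; case: eqP => [->//|/eqP kj].
    by apply/esym/eqP; apply: (implyP (h k)).
  by move: px; rewrite e ip py.
(* Grouped by the digit at [j], the sum keeps at most one nonzero term per digit [a], the one at
   [upd y j a]. *)
rewrite (partition_big (fun x => x j) predT) //=; apply: eq_bigr => a _.
rewrite (bigD1 (upd y j a)) /= ?upd_same //.
rewrite ip py /local_entry upd_same.
have -> : [forall k, (k != j) ==> (y k == upd y j a k)].
  by apply/forallP => k; apply/implyP => kj; rewrite upd_neq.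
rewrite mulr1 big1 ?addr0 // => x /andP [/eqP xj xn].
have xe : [forall k, (k != j) ==> (y k == x k)] = false.
  apply/negP => /forallP h; case/eqP: xn; apply/ffunP => k.
  rewrite ffunE; case: eqP => [->//|/eqP kj].
  by apply/esym/eqP; apply: (implyP (h k)).
rewrite xe mulr0; case: ifP => px; rewrite ?mul0r //.
case: eqP => [e|_]; last by rewrite mul0r.
by rewrite -e py in px.
Qed.

Lemma ctl_mxM p j u u' : indep p j ->
  ctl_mx p j u *m ctl_mx p j u' = ctl_mx p j (u *m u').
Proof.
move=> ip; apply: mx_coef_ext => v y; rewrite -mulmxA !coef_ctl //.
case: ifP => py; rewrite ?py //.
under eq_bigr => a _ do rewrite coef_ctl // ip py upd_same.
under [RHS]eq_bigr => a _ do rewrite mxE mulr_suml.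
rewrite exchange_big /=; apply: eq_bigr => a _.
rewrite mulr_sumr; apply: eq_bigr => b _.
by rewrite upd_upd mulrA.
Qed.

Lemma ctl_mx1 p j : indep p j -> ctl_mx p j 1%:M = 1%:M.
Proof.
move=> ip; apply: mx_coef_ext => v y; rewrite coef_ctl // mul1mx.
case: ifP => // py; rewrite (bigD1 (y j)) //= mxE eqxx mul1r upd_id.
by rewrite big1 ?addr0 // => a aj; rewrite mxE eq_sym (negbTE aj) mul0r.
Qed.

Lemma ctl_mx_adj p j u : indep p j -> (ctl_mx p j u)^t* = ctl_mx p j (u^t*).
Proof.
move=> ip; apply/matrixP => y x; rewrite !mxE /local_entry.
set y' := enum_val y; set x' := enum_val x.
case: (boolP [forall k, (k != j) ==> (y' k == x' k)]) => [/forallP h | nh].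
  have e : x' = upd y' j (x' j).
    apply/ffunP => k; rewrite ffunE; case: eqP => [->//|/eqP kj].
    by apply/esym/eqP; apply: (implyP (h k)).
  have -> : p x' = p y' by rewrite e ip.
  have -> : [forall k, (k != j) ==> (x' k == y' k)].
    by apply/forallP => k; rewrite [x' k == _]eq_sym; apply: h.
  by case: ifP => _; rewrite ?mulr1 ?mxE // rmorph_nat eq_sym.
have nh' : [forall k, (k != j) ==> (x' k == y' k)] = false.
  apply/negP => /forallP h; case/negP: nh; apply/forallP => k.
  by rewrite [y' k == _]eq_sym; apply: h.
have yx : (x == y) = false.
  apply/negP => /eqP e; case/negP: nh; apply/forallP => k.
  by rewrite /y' /x' e eqxx implybT.
rewrite nh' [y == x]eq_sym yx !mulr0.
by case: ifP => _; case: ifP => _; exact: conjC0.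
Qed.

Lemma ctl_mx_unitary p j u : indep p j -> u \is unitarymx ->
  ctl_mx p j u \is unitarymx.
Proof.
move=> ip /unitarymxP uu; apply/unitarymxP.
by rewrite ctl_mx_adj // ctl_mxM // uu ctl_mx1.
Qed.

End Controlled.

(** * The increment X_d and its inverse *)

Section Xgate.
Variables (C : numClosedFieldType) (d : nat).

Lemma XgateE a b : Xgate C d b a = (b == ordS a)%:R.
Proof.
rewrite /Xgate summxE (bigD1 a) //= mxE eqxx andbT big1 ?addr0 // => k ka.
by rewrite mxE [a == k]eq_sym (negbTE ka) andbF.
Qed.

Lemma perm_like_unitary (f : 'I_d -> 'I_d) : injective f ->
  \matrix_(b, a) (b == f a)%:R \is @unitarymx C d d.
Proof.
move=> fI; apply/unitarymxP; apply: mulmx1C; apply/matrixP => i j.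
rewrite mxE (bigD1 (f i)) //= !mxE eqxx conjC1 mul1r (inj_eq fI).
by rewrite big1 ?addr0 // => k ki; rewrite !mxE (negbTE ki) conjC0 mul0r.
Qed.

Lemma Xgate_unitary : Xgate C d \is unitarymx.
Proof.
have -> : Xgate C d = \matrix_(b, a) (b == ordS a)%:R.
  by apply/matrixP => b a; rewrite XgateE mxE.
exact/perm_like_unitary/ordS_inj.
Qed.

Lemma Xgate_mulmx n (v : 'M[C]_(d, n)) b c :
  (Xgate C d *m v) b c = v (ord_pred b) c.
Proof.
rewrite mxE (bigD1 (ord_pred b)) //= XgateE ord_predK eqxx mul1r.
rewrite big1 ?addr0 // => k kb; rewrite XgateE.
case: eqP => [e|_]; last by rewrite mul0r.
by case/eqP: kb; rewrite e ordSK.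
Qed.

Lemma rev_ordS (a : 'I_d) : rev_ord (ordS (rev_ord a)) = ord_pred a.
Proof.
apply: val_inj => /=; case: a => a ad /=.
(* For a = 0 both sides wrap around to d - 1. *)
case: a ad => [|a] ad.
  have -> : (d - 1).+1 = d by lia.
  by rewrite modnn add0n modn_small ?subn1 // prednK.
rewrite modn_small; last by lia.
have -> : (a.+1 + d).-1 = (a + d)%N by lia.
by rewrite modnDr modn_small; lia.
Qed.

(** The map a -> d - 1 - a is negation modulo d up to a shift, and shifts commute with X_d. *)
Definition rev_mx : 'M[C]_d := \matrix_(b, a) (b == rev_ord a)%:R.

Lemma rev_mx_unitary : rev_mx \is unitarymx.
Proof. exact/perm_like_unitary/rev_ord_inj. Qed.

Lemma rev_mx_mul n (v : 'M[C]_(d, n)) b c : (rev_mx *m v) b c = v (rev_ord b) c.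
Proof.
rewrite mxE (bigD1 (rev_ord b)) //= mxE rev_ordK eqxx mul1r.
rewrite big1 ?addr0 // => k kb; rewrite mxE.
case: eqP => [e|_]; last by rewrite mul0r.
by case/eqP: kb; rewrite e rev_ordK.
Qed.

(* Negation modulo d conjugates the increment into its inverse. *)
Lemma Xgate_adj : (Xgate C d)^t* = rev_mx *m Xgate C d *m rev_mx.
Proof.
apply/matrixP => b a; rewrite -mulmxA rev_mx_mul Xgate_mulmx !mxE XgateE rmorph_nat.
by rewrite -rev_ordS rev_ordK (inj_eq rev_ord_inj) eq_sym.
Qed.

End Xgate.

(** * Circuits and their CINC counts *)

Section Circuits.
Variables (C : numClosedFieldType) (d m : nat).
Implicit Types (x y : basis d m) (i j t : 'I_m) (a b : 'I_d).
Implicit Types (p : pred (basis d m)) (u V : 'M[C]_d) (v : 'cV[C]_(qdim d m)).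

Definition realizable N (A : 'M[C]_(qdim d m)) :=
  exists c : circuit C d m, circuit_mx c = A /\ (cinc_count c <= N)%N.

Lemma circuit_mx_cat (c1 c2 : circuit C d m) :
  circuit_mx (c1 ++ c2) = circuit_mx c1 *m circuit_mx c2.
Proof. by elim: c1 => [|g c1 IH] /=; rewrite ?mul1mx // IH mulmxA. Qed.

Lemma realizable1 : realizable 0 1%:M.
Proof. by exists [::]. Qed.

Lemma realizable_le N N' A : (N <= N')%N -> realizable N A -> realizable N' A.
Proof. by move=> NN' [c [cA cN]]; exists c; split=> //; apply: leq_trans NN'. Qed.

Lemma realizableM N N' A B :
  realizable N A -> realizable N' B -> realizable (N + N') (A *m B).
Proof.
move=> [c [<- cN]] [c' [<- cN']]; exists (c ++ c').
by rewrite circuit_mx_cat /cinc_count count_cat leq_add.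
Qed.

Lemma realizable_local j u : u \is unitarymx -> realizable 0 (ctl_mx predT j u).
Proof. by move=> uu; exists [:: Single j uu]; rewrite /= mulmx1. Qed.

Lemma coef_ctlT p j u v y : indep p j -> p y ->
  coef (ctl_mx p j u *m v) y = coef (ctl_mx predT j u *m v) y.
Proof. by move=> ip py; rewrite !coef_ctl ?py. Qed.

Lemma coef_ctlF p j u v y : indep p j -> ~~ p y ->
  coef (ctl_mx p j u *m v) y = coef v y.
Proof. by move=> ip py; rewrite !coef_ctl // (negbTE py). Qed.

(** The outer factors need no control: where [p] fails they cancel each other. Hence conjugating the
    controlled operator costs no CINC. *)
Lemma ctl_conj p j u V : indep p j -> V \is unitarymx ->
  ctl_mx predT j V *m ctl_mx p j u *m ctl_mx predT j (V^t*)
    = ctl_mx p j (V *m u *m V^t*).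
Proof.
move=> ip uV; have iT : indep predT j by [].
apply: mx_coef_ext => v y; rewrite -!mulmxA.
have [py|py] := boolP (p y).
  rewrite [RHS]coef_ctlT // -!ctl_mxM // -!mulmxA !(coef_ctl V) //=.
  by apply: eq_bigr => a _; rewrite coef_ctlT // ip.
rewrite [RHS]coef_ctlF // coef_ctl //=.
under eq_bigr => a _ do rewrite coef_ctlF ?ip //.
rewrite -[LHS](@coef_ctl C d m predT) // mulmxA ctl_mxM //.
by rewrite (unitarymxP uV) ctl_mx1 // mul1mx.
Qed.

Lemma realizable_conj N p j u V : indep p j -> V \is unitarymx ->
  realizable N (ctl_mx p j u) -> realizable N (ctl_mx p j (V *m u *m V^t*)).
Proof.
move=> ip uV ru; rewrite -ctl_conj // -[N]addn0 -[N]add0n.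
by do 2?apply: realizableM => //; apply: realizable_local; rewrite ?trmxC_unitary.
Qed.

Lemma realizable_cinc i j : i != j ->
  realizable 1 (ctl_mx (fun x => x i == d.-1 :> nat) j (Xgate C d)).
Proof. by move=> ij; exists [:: Cinc C d ij]; rewrite /= mulmx1. Qed.

Lemma indep_val i j k : i != j -> indep (fun x : basis d m => x i == k :> nat) j.
Proof. by move=> ij x a; rewrite upd_neq. Qed.

Lemma rev_mx_adj : (rev_mx C d)^t* = rev_mx C d.
Proof.
apply/matrixP => b a; rewrite !mxE rmorph_nat.
by rewrite -(inj_eq rev_ord_inj) rev_ordK eq_sym.
Qed.

(** The adjoint of a CINC is a CINC conjugated by single-qudit gates on its target, so reversing a
    circuit keeps the count. *)
Lemma realizable_adj N A : realizable N A -> realizable N (A^t*).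
Proof.
move=> [c [<-]]; elim: c N => [|g c IH] N /=.
  by rewrite trCmx1 => _; apply: realizable_le realizable1.
move=> cN; rewrite trCmx_mul; case: g cN => [i j ij|j u uu] /= cN.
  rewrite -(@subnK 1 N); last by rewrite (leq_trans _ cN) ?leq_addr.
  apply: realizableM.
    apply: IH; rewrite -(leq_add2l 1).
    by rewrite subnKC ?(leq_trans _ cN) ?leq_addr.
  rewrite cinc_mxE ctl_mx_adj; last exact: indep_val.
  rewrite Xgate_adj -[X in _ *m X]rev_mx_adj.
  by apply: realizable_conj (rev_mx_unitary _ _) (realizable_cinc ij); apply: indep_val.
rewrite -[N]addn0; apply: realizableM; first exact: IH.
rewrite local_mxE ctl_mx_adj //; apply: realizable_local.
by rewrite trmxC_unitary.
Qed.

Lemma realizable_unitary N A : realizable N A -> A \is unitarymx.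
Proof.
move=> [c [<- _]]; elim: c => [|g c IH] /=; first exact: unitarymx1.
apply: mul_unitarymx IH; case: g => [i j ij|j u uu] /=.
  rewrite cinc_mxE; apply: ctl_mx_unitary; first exact: indep_val.
  exact: Xgate_unitary.
by rewrite local_mxE; apply: ctl_mx_unitary.
Qed.

Lemma coef_ctlX p j v y : indep p j ->
  coef (ctl_mx p j (Xgate C d) *m v) y =
    coef v (if p y then upd y j (ord_pred (y j)) else y).
Proof.
move=> ip; rewrite coef_ctl //; case: ifP => // py.
rewrite (bigD1 (ord_pred (y j))) //= XgateE ord_predK eqxx mul1r.
rewrite big1 ?addr0 // => a aj; rewrite XgateE.
case: eqP => [e|_]; last by rewrite mul0r.
by case/eqP: aj; rewrite e ordSK.
Qed.

Lemma coef_ctlX_adj p j v y : indep p j ->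
  coef (ctl_mx p j ((Xgate C d)^t*) *m v) y =
    coef v (if p y then upd y j (ordS (y j)) else y).
Proof.
move=> ip; rewrite coef_ctl //; case: ifP => // py.
rewrite (bigD1 (ordS (y j))) //= !mxE XgateE eqxx conjC1 mul1r.
rewrite big1 ?addr0 // => a aj; rewrite !mxE XgateE (negbTE aj).
by rewrite conjC0 mul0r.
Qed.

(** A single-qudit transposition of [b] and d - 1 on the control, before and after a CINC, moves its
    firing digit to [b]. *)
Lemma realizable_ctlX i j b : i != j ->
  realizable 1 (ctl_mx (fun x => x i == b) j (Xgate C d)).
Proof.
move=> ij; have d0 : (d.-1 < d)%N by case: d b => [[]|].
pose l := Ordinal d0; pose f := tperm b l.
pose P : 'M[C]_d := \matrix_(b', a) (b' == f a)%:R.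
have uP : P \is unitarymx by apply/perm_like_unitary/perm_inj.
have coefP w y : coef (ctl_mx predT i P *m w) y = coef w (upd y i (f (y i))).
  rewrite coef_ctl //= (bigD1 (f (y i))) //= mxE tpermK eqxx mul1r.
  rewrite big1 ?addr0 // => a ai; rewrite mxE.
  case: eqP => [e|_]; last by rewrite mul0r.
  by case/eqP: ai; rewrite e tpermK.
have -> : ctl_mx (fun x => x i == b) j (Xgate C d) =
    ctl_mx predT i P *m ctl_mx (fun x => x i == d.-1 :> nat) j (Xgate C d)
      *m ctl_mx predT i P.
  apply: mx_coef_ext => w y; rewrite -!mulmxA coefP.
  rewrite !coef_ctlX ?coefP; [|exact: indep_val|exact: indep_eq].
  rewrite upd_same.
  have -> : (f (y i) == d.-1 :> nat) = (y i == b).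
    rewrite -[RHS](inj_eq (@perm_inj _ f)) /f tpermL.
    by rewrite -val_eqE.
  case: eqP => _; last by rewrite upd_upd upd_same tpermK upd_id.
  rewrite [upd y i _ j]upd_neq 1?eq_sym // upd_neq // upd_same tpermK.
  by rewrite (updC y) // upd_upd -(updC y) // upd_id.
rewrite -[1%N]addn0 -[1%N]add0n.
by do 2?apply: realizableM; try exact: realizable_local; apply: realizable_cinc.
Qed.

Definition dg (f : basis d m -> C) : 'M[C]_(qdim d m) :=
  diag_mx (\row_r f (enum_val r)).

Lemma coef_dg f v y : coef (dg f *m v) y = f y * coef v y.
Proof. by rewrite /coef /dg mul_diag_mx !mxE enum_rankK. Qed.

Lemma coef_ctl_diag p j (S : 'I_d -> C) v y : indep p j ->
  coef (ctl_mx p j (diag_mx (\row_a S a)) *m v) y =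
    (if p y then S (y j) else 1) * coef v y.
Proof.
move=> ip; rewrite coef_ctl //; case: ifP => _; last by rewrite mul1r.
rewrite (bigD1 (y j)) //= !mxE eqxx mulr1n upd_id big1 ?addr0 // => a aj.
by rewrite !mxE eq_sym (negbTE aj) mulr0n mul0r.
Qed.

End Circuits.

(** * Multiply controlled phases *)

Lemma telescoping_phases (C : numClosedFieldType) d (S : 'I_d -> C) : (0 < d)%N ->
  (forall a, `|S a| = 1) -> \prod_a S a = 1 ->
  exists E : 'I_d -> C, [/\ forall a, `|E a| = 1, \prod_a E a = 1
    & forall a, S a = E a * (E (ord_pred a))^*].
Proof.
(* The partial products satisfy E0 b = S b * E0 (b - 1). At b = 0 the predecessor is d - 1, whose
   partial product is the full one, equal to 1 by [pS]. *)
move=> d0 nS pS; pose E0 (b : 'I_d) := \prod_(i < d | (i <= b)%N) S i.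
have nE0 b : `|E0 b| = 1 by rewrite normr_prod big1.
have SE0 b : E0 b = S b * E0 (ord_pred b).
  rewrite /E0 (bigD1 b) //=; congr (_ * _).
  have [b0|b0] := posnP b.
    rewrite big_pred0 => [|i]; last first.
      by rewrite b0 leqn0 -b0 (inj_eq val_inj) andbN.
    rewrite -[LHS]pS; apply: eq_bigl => i.
    rewrite b0 add0n modn_small ?prednK //.
    by apply/esym; have := ltn_ord i; lia.
  apply: eq_bigl => i; rewrite -(inj_eq val_inj) /=.
  have -> : ((b + d).-1 = b.-1 + d)%N by lia.
  have bd := ltn_ord b.
  by rewrite modnDr modn_small; lia.
(* Scaling by [k] leaves the ratios unchanged and makes the product of [E] equal to 1, so that [E]
   can play the role of [S] in the recursion on controls. *)
pose k := d.-root (\prod_a E0 a)^*.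
have nk : `|k| = 1.
  by apply: norm_rootC1 => //; rewrite norm_conjC normr_prod big1.
exists (fun a => k * E0 a); split=> [a||a].
- by rewrite normrM nk nE0 mulr1.
- rewrite big_split /= prodr_const card_ord rootCK // mulrC norm1_conjC //.
  by rewrite normr_prod big1.
rewrite rmorphM mulrACA norm1_conjC // mul1r SE0 -mulrA norm1_conjC //.
by rewrite mulr1.
Qed.

Section Phases.
Variables (C : numClosedFieldType) (d m : nat) (z : 'I_d).
Implicit Types (y : basis d m) (t : 'I_m) (S : 'I_d -> C).

Definition low c y := [forall k : 'I_m, (k < c)%N ==> (y k == z)].

Lemma low0 y : low 0 y.
Proof. by apply/forallP. Qed.

Lemma lowS t y : low t.+1 y = low t y && (y t == z).
Proof.
apply/forallP/andP => [h|[/forallP h yt] k].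
  split; last exact: (implyP (h t)).
  by apply/forallP => k; apply/implyP => kt; apply: (implyP (h k)); apply: ltnW.
apply/implyP; rewrite ltnS leq_eqVlt => /orP [/eqP kt|kt].
  by rewrite (val_inj kt).
exact: (implyP (h k)).
Qed.

Lemma low_upd c y t a : (c <= t)%N -> low c (upd y t a) = low c y.
Proof.
move=> ct; apply: eq_forallb => k; case: ltnP => //= kc.
by rewrite upd_neq // -(inj_eq val_inj) /= ltn_eqF // (leq_trans kc).
Qed.

Definition ctl_diag c t S : 'M[C]_(qdim d m) :=
  dg (fun y => if low c y then S (y t) else 1).

(* With S a = E a / E (a - 1), the controlled S is the group commutator of the
   controlled E, which needs one control less, and of a controlled increment. *)
Lemma realizable_ctl_diag c t S : (c <= t)%N ->
  (forall a, `|S a| = 1) -> \prod_a S a = 1 ->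
  realizable (2 ^ c.+1 - 2) (ctl_diag c t S).
Proof.
elim: c S => [|c IH] S ct nS pS.
  have -> : ctl_diag 0 t S = ctl_mx predT t (diag_mx (\row_a S a)).
    apply: mx_coef_ext => v y; rewrite coef_dg coef_ctl_diag //.
    by rewrite low0.
  by apply: realizable_local; apply: diag_unitary.
have d0 : (0 < d)%N by case: d z => [[]|].
have cm : (c < m)%N by rewrite (leq_trans ct) // ltnW.
pose i := Ordinal cm.
have it : i != t by rewrite -(inj_eq val_inj) /= ltn_eqF.
have [E [nE pE SE]] := telescoping_phases d0 nS pS.
pose p (y : basis d m) := y i == z.
have ip : indep p t by apply: indep_eq.
(* Where digit [i] is z, the increments shift E^* to the index a - 1; elsewhere they are absent and
   E cancels E^*. *)
have -> : ctl_diag c.+1 t S = ctl_diag c t E *m (ctl_mx p t (Xgate C d) *m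
    (ctl_diag c t (fun a => (E a)^*) *m ctl_mx p t ((Xgate C d)^t*))).
  apply: mx_coef_ext => v y; rewrite -!mulmxA !coef_dg coef_ctlX //.
  rewrite coef_dg coef_ctlX_adj // (lowS i y : low c.+1 y = low c y && (y i == z)) /p.
  case: eqP => yi.
    rewrite andbT low_upd ?(ltnW ct) // !upd_same ord_predK upd_neq // yi eqxx upd_upd.
    rewrite upd_id mulrA; case: (low c y); last by rewrite !mul1r.
    by rewrite SE.
  rewrite andbF (introF eqP yi) mulrA; case: (low c y); last by rewrite !mul1r.
  by rewrite norm1_conjC.
have rX : realizable 1 (ctl_mx p t (Xgate C d)) by apply: realizable_ctlX.
have rXa : realizable 1 (ctl_mx p t ((Xgate C d)^t*)).
  by rewrite -ctl_mx_adj //; apply: realizable_adj.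
have rE : realizable (2 ^ c.+1 - 2) (ctl_diag c t E) by apply: IH => //; apply: ltnW.
have rEa : realizable (2 ^ c.+1 - 2) (ctl_diag c t (fun a => (E a)^*)).
  apply: IH => [|a|]; [exact: ltnW | by rewrite norm_conjC | ].
  by rewrite -rmorph_prod pE rmorph1.
(* The bound solves f(0) = 0, f(c + 1) = 2 f(c) + 2. *)
apply: realizable_le (realizableM rE (realizableM rX (realizableM rEa rXa))).
have : (0 < 2 ^ c)%N by rewrite expn_gt0.
by rewrite !expnS; lia.
Qed.

Definition low_phase c (l : C) : 'M[C]_(qdim d m) :=
  dg (fun y => if low c y then l else 1).

(** With k a d-th root of l, the phase on c + 1 digits is the phase k on c digits times a controlled
    diagonal of determinant 1: its entry k^(d-1) at z completes k to l, and k^* elsewhere cancels k.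
    The bound sums the costs 2^(c+1) - 2 of these diagonals. *)
Lemma realizable_low_phase c l : (0 < m)%N -> (c <= m)%N -> `|l| = 1 ->
  realizable (2 * (2 ^ c - 1 - c)) (low_phase c l).
Proof.
move=> m0; have d0 : (0 < d)%N by case: d z => [[]|].
elim: c l => [|c IH] l cm nl.
  have -> : low_phase 0 l = ctl_mx predT (Ordinal m0) (diag_mx (\row_(a < d) l)).
    by apply: mx_coef_ext => v y; rewrite coef_dg coef_ctl_diag // low0.
  by apply: realizable_local; apply: diag_unitary.
pose k := d.-root l; have nk : `|k| = 1 by apply: norm_rootC1.
pose t := Ordinal cm; pose S a := if a == z then k ^+ d.-1 else k^*.
have -> : low_phase c.+1 l = low_phase c k *m ctl_diag c t S.
  apply: mx_coef_ext => v y; rewrite -mulmxA !coef_dg mulrA.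
  rewrite (lowS t y : low c.+1 y = low c y && (y t == z)).
  case: (low c y) => /=; last by rewrite !mul1r.
  rewrite /S; case: eqP => _; last by rewrite norm1_conjC.
  by rewrite -exprS prednK // rootCK.
have rS : realizable (2 ^ c.+1 - 2) (ctl_diag c t S).
  apply: realizable_ctl_diag => // [a|].
    by rewrite /S; case: ifP => _; rewrite ?normrX ?norm_conjC nk ?expr1n.
  rewrite (bigD1 z) //= /S eqxx.
  rewrite (eq_bigr (fun=> k^*)) => [|a /negbTE -> //].
  rewrite prodr_const cardC1 card_ord -exprMn norm1_conjC //.
  by rewrite expr1n.
apply: realizable_le (realizableM (IH _ (ltnW cm) nk) rS).
have : (c < 2 ^ c)%N by apply: ltn_expl.
by rewrite !expnS; lia.
Qed.

End Phases.

(** * Inner products and complex Householder reflections *)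

Section Householder.
Variable C : numClosedFieldType.

Definition ip n (u v : 'cV[C]_n) : C := (u^t* *m v) 0 0.

Lemma ipE n (u v : 'cV[C]_n) : ip u v = \sum_i (u i 0)^* * v i 0.
Proof. by rewrite /ip mxE; apply: eq_bigr => i _; rewrite !mxE. Qed.

Lemma ipC n (u v : 'cV[C]_n) : ip u v = (ip v u)^*.
Proof.
rewrite !ipE rmorph_sum; apply: eq_bigr => i _.
by rewrite rmorphM /= conjCK mulrC.
Qed.

Lemma ipBl n (u v w : 'cV[C]_n) : ip (u - v) w = ip u w - ip v w.
Proof.
rewrite !ipE -sumrB; apply: eq_bigr => i _.
by rewrite !mxE rmorphB mulrBl.
Qed.

Lemma ipBr n (u v w : 'cV[C]_n) : ip u (v - w) = ip u v - ip u w.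
Proof. by rewrite ipC ipBl rmorphB /= -!ipC. Qed.

Lemma ipZr n a (u v : 'cV[C]_n) : ip u (a *: v) = a * ip u v.
Proof. by rewrite /ip -scalemxAr mxE. Qed.

Lemma ipZl n a (u v : 'cV[C]_n) : ip (a *: u) v = a^* * ip u v.
Proof. by rewrite ipC ipZr rmorphM /= -ipC. Qed.

Lemma ip_unitary n (A : 'M[C]_n) (u v : 'cV_n) : A \is unitarymx ->
  ip (A *m u) (A *m v) = ip u v.
Proof.
by move=> uA; rewrite /ip trCmx_mul -mulmxA (mulmxA _ A) unitary_mulVmx // mul1mx.
Qed.

Lemma ip_ge0 n (u : 'cV[C]_n) : 0 <= ip u u.
Proof.
by rewrite ipE; apply: sumr_ge0 => i _; rewrite mulrC mul_conjC_ge0.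
Qed.

Lemma ip_eq0 n (u : 'cV[C]_n) : (ip u u == 0) = (u == 0).
Proof.
apply/eqP/eqP => [|->]; last by rewrite /ip mulmx0 mxE.
rewrite ipE => /eqP; rewrite psumr_eq0 => [/allP h|i _]; last first.
  by rewrite mulrC mul_conjC_ge0.
apply/matrixP => i j; rewrite (ord1 j) mxE.
by apply/eqP; rewrite -mul_conjC_eq0 mulrC; apply: h; rewrite mem_index_enum.
Qed.

Lemma ip_conj n (u : 'cV[C]_n) : (ip u u)^* = ip u u.
Proof. by rewrite -ipC. Qed.

Lemma ip_delta n (i : 'I_n) (u : 'cV[C]_n) : ip (delta_mx i 0) u = u i 0.
Proof.
rewrite ipE (bigD1 i) //= mxE !eqxx conjC1 mul1r big1 ?addr0 // => k ki.
by rewrite mxE (negbTE ki) conjC0 mul0r.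
Qed.

(** The scalar [l] is the eigenvalue on [w]. Allowing values other than -1 is what handles vectors
    whose inner product is not real. *)
Definition reflection n (w : 'cV[C]_n) (l : C) : 'M[C]_n :=
  1%:M - ((1 - l) / ip w w) *: (w *m w^t*).

Lemma reflection_mul n (w x : 'cV[C]_n) l :
  reflection w l *m x = x - ((1 - l) / ip w w * ip w x) *: w.
Proof.
rewrite mulmxBl mul1mx -scalemxAl -mulmxA -scalerA; congr (_ - _ *: _).
by rewrite [w^t* *m x]mx11_scalar mul_mx_scalar.
Qed.

Lemma reflection_unitary n (w : 'cV[C]_n) l : `|l| = 1 ->
  reflection w l \is unitarymx.
Proof.
move=> nl; apply/unitarymxP; have ll := norm1_conjC nl.
have -> : (reflection w l)^t* = 1%:M - ((1 - l^*) / ip w w) *: (w *m w^t*).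
  rewrite /reflection linearB /= map_mxB trmx1 map_mx1 trCmxZ trCmx_mul trCmxK.
  by rewrite fmorph_div /= rmorphB /= conjC1 ip_conj.
have PP : w *m w^t* *m (w *m w^t*) = ip w w *: (w *m w^t*).
  rewrite mulmxA -[w *m _ *m w]mulmxA [w^t* *m w]mx11_scalar.
  by rewrite mul_mx_scalar -scalemxAl.
rewrite mulmxBl mul1mx mulmxBr mulmx1 -scalemxAl -scalemxAr PP !scalerA.
have [-> | w0] := eqVneq w 0; first by rewrite mul0mx !scaler0 !subr0.
have s0 : ip w w != 0 by rewrite ip_eq0.
apply/matrixP => i j; rewrite !mxE -[RHS]addr0 -!addrA; congr (_ + _).
set q := \sum__ _.
have -> : (1 - l) / ip w w * ((1 - l^*) / ip w w) * ip w w
   = (1 - l - l^* + l * l^*) / ip w w by field.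
by rewrite ll; ring.
Qed.

(** Put w = u - v and p = <w, u>. Equal norms give <w, w> = p + p^*, so l = - p^* / p has modulus 1
    and (1 - l) p / <w, w> = 1, which subtracts exactly w from u. *)
Lemma householder n (u v : 'cV[C]_n) : ip u u = ip v v ->
  exists l, [/\ `|l| = 1, reflection (u - v) l *m u = v
    & forall x, ip (u - v) x = 0 -> reflection (u - v) l *m x = x].
Proof.
move=> uv.
have fixed l x : ip (u - v) x = 0 -> reflection (u - v) l *m x = x.
  by move=> h; rewrite reflection_mul h mulr0 scale0r subr0.
have [e|w0] := eqVneq (u - v) 0.
  exists 1; split; [exact: normr1| |exact: fixed].
  rewrite fixed; first exact/subr0_eq.
  by rewrite e ipE big1 // => i _; rewrite mxE conjC0 mul0r.
pose p := ip (u - v) u; pose s := ip (u - v) (u - v).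
have s0 : s != 0 by rewrite ip_eq0.
have sp : s = p + p^*.
  rewrite /s /p -[(ip (u - v) u)^*]ipC !ipBr !ipBl -uv; ring.
have p0 : p != 0.
  by apply: contraNneq s0 => p0; rewrite sp p0 conjC0 addr0.
exists (- p^* / p); split; last exact: fixed.
  by rewrite normrM normrN norm_conjC normfV mulfV // normr_eq0.
rewrite reflection_mul -/p -/s.
have -> : (1 - - p^* / p) / s * p = 1 by rewrite sp; field; rewrite -sp s0 p0.
by rewrite scale1r opprB addrCA subrr addr0.
Qed.

End Householder.

(** * Sending a vector of one qudit to a basis direction by a conjugate of X_d *)

Section SingleQudit.
Variables (C : numClosedFieldType) (d : nat) (z : 'I_d).

(** Take xi = al |z> + be (sum of all |a>) with real al, be. Its overlap is 2 al be + d be^2 and its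
    squared norm is al^2 more, so al^2 = 1 - t and [be] is a root of the quadratic d be^2 + 2 al be
    = t. *)
Lemma Xgate_overlap (t : C) : (1 < d)%N -> 0 <= t <= 1 ->
  exists xi : 'cV[C]_d, ip xi xi = 1 /\ ip xi (Xgate C d *m xi) = t.
Proof.
move=> d1 /andP [t0 t1].
have dn0 : d%:R != 0 :> C by rewrite pnatr_eq0; case: d d1.
pose al := sqrtC (1 - t); pose g := sqrtC (1 - t + d%:R * t).
have al0 : 0 <= al by rewrite sqrtC_ge0 subr_ge0.
have g0 : 0 <= g by rewrite sqrtC_ge0 addr_ge0 ?subr_ge0 ?mulr_ge0 ?ler0n.
have al2 : al ^+ 2 = 1 - t by rewrite sqrtCK.
have g2 : g ^+ 2 = 1 - t + d%:R * t by rewrite sqrtCK.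
pose be := (g - al) / d%:R.
have alC : al^* = al by apply/CrealP/ger0_real.
have beC : be^* = be.
  by apply/CrealP/rpredM; [apply: rpredB; apply: ger0_real | rewrite realV realn].
have be2 : al * be + be * al + d%:R * (be * be) = t.
  rewrite /be.
  have -> : t = (g ^+ 2 - al ^+ 2) / d%:R by rewrite g2 al2; field.
  by field.
have sumc (c : C) : \sum_(a < d) c = d%:R * c.
  by rewrite sumr_const card_ord mulr_natl.
pose xi : 'cV[C]_d := \col_a (al * (a == z)%:R + be).
have xiC a : (xi a 0)^* = al * (a == z)%:R + be.
  by rewrite mxE rmorphD rmorphM /= alC beC rmorph_nat.
have sumz : \sum_(a < d) (a == z)%:R = 1 :> C.
  by rewrite (bigD1 z) //= eqxx big1 ?addr0 // => a /negbTE ->.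
have sumpz : \sum_(a < d) (ord_pred a == z)%:R = 1 :> C.
  rewrite (bigD1 (ordS z)) //= ordSK eqxx big1 ?addr0 // => a az.
  by rewrite -(inj_eq (@ordS_inj d)) ord_predK (negbTE az).
exists xi; split; rewrite ipE.
  under eq_bigr => a _.
    rewrite xiC mxE.
    have -> : (al * (a == z)%:R + be) * (al * (a == z)%:R + be) =
      (al ^+ 2 + (al * be + be * al)) * (a == z)%:R + be * be.
      by case: (a == z) => /=; ring.
    over.
  rewrite big_split /= sumc -mulr_sumr sumz mulr1 -addrA be2 al2; ring.
under eq_bigr => a _.
  rewrite xiC Xgate_mulmx mxE.
  have -> : (al * (a == z)%:R + be) * (al * (ord_pred a == z)%:R + be) =
    al * be * (a == z)%:R + be * al * (ord_pred a == z)%:R + be * be.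
    (* Since d > 1, z differs from its predecessor, and the cross term al^2 drops out. *)
    have : (a == z)%:R * (ord_pred a == z)%:R = 0 :> C.
      case: (a =P z) => [->|_]; last by rewrite mul0r.
      case: eqP => [e|_]; last by rewrite mulr0.
      have : val (ord_pred z) = val z by rewrite e.
      rewrite /=; case: (val z) (ltn_ord z) => [|k] kd.
        by rewrite add0n modn_small; lia.
      have -> : (k.+1 + d).-1 = (k + d)%N by lia.
      by rewrite modnDr modn_small; lia.
    move: (a == z)%:R (ord_pred a == z)%:R => p q pq.
    have -> : (al * p + be) * (al * q + be) =
      al ^+ 2 * (p * q) + (al * be * p + be * al * q + be * be) by ring.
    by rewrite pq mulr0 add0r.
  over.
by rewrite !big_split /= sumc -!mulr_sumr sumz sumpz !mulr1 be2.
Qed.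

(* Two pairs of unit vectors with equal inner products are unitarily
   equivalent; a conjugate of X_d maps phi to a multiple of |z> because the
   overlaps <xi|X_d|xi> take every value in [0, 1]. *)
Lemma Xgate_conj_to_basis (phi : 'cV[C]_d) : (1 < d)%N ->
  exists2 V : 'M[C]_d, V \is unitarymx
    & forall a, a != z -> (V *m Xgate C d *m V^t* *m phi) a 0 = 0.
Proof.
move=> d1; have [->|phi0] := eqVneq phi 0.
  by exists 1%:M; [exact: unitarymx1 | move=> a _; rewrite mulmx0 mxE].
pose r := sqrtC (ip phi phi).
have r2 : r ^+ 2 = ip phi phi by rewrite sqrtCK.
have rC : r^* = r by apply/CrealP/ger0_real; rewrite sqrtC_ge0 ip_ge0.
have r0 : r != 0 by rewrite sqrtC_eq0 ip_eq0.
pose psi := r^-1 *: phi.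
have psi1 : ip psi psi = 1.
  by rewrite ipZl ipZr fmorphV /= rC -r2; field.
pose c := psi z 0; pose t := `|c|.
have t01 : 0 <= t <= 1.
  rewrite normr_ge0 -(@expr_le1 _ 2) ?normr_ge0 // normCK mulrC -psi1 ipE.
  rewrite (bigD1 z) //= lerDl; apply: sumr_ge0 => a _.
  by rewrite mulrC mul_conjC_ge0.
have [xi [xi1 xiX]] := Xgate_overlap d1 t01.
(* This phase makes <om |z>, psi> equal to the real number t, matching <xi, X_d xi>. *)
pose om := if c == 0 then 1 else c / t.
have nom : `|om| = 1.
  rewrite /om; case: eqP => [_|/eqP c0]; first exact: normr1.
  by rewrite normrM normfV normr_id mulfV // normr_eq0.
have omc : om^* * c = t.
  rewrite /om /t; case: eqP => [->|/eqP c0]; first by rewrite normr0 mulr0.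
  rewrite fmorph_div /= (_ : (`|c|)^* = `|c|); last exact/CrealP/normr_real.
  rewrite mulrAC [c^* * c]mulrC -normCK expr2 mulfK // normr_eq0.
  exact: c0.
pose e : 'cV[C]_d := om *: delta_mx z 0.
have e1 : ip e e = 1.
  by rewrite ipZl ipZr ip_delta mxE !eqxx mulr1 mulrC norm1_conjC.
have [l1 [nl1 H1xi _]] := householder (etrans xi1 (esym psi1)).
set H1 := reflection _ _ in H1xi.
have uH1 : H1 \is unitarymx by apply: reflection_unitary.
pose eta := H1 *m (Xgate C d *m xi).
have eta1 : ip eta eta = 1 by rewrite !ip_unitary ?Xgate_unitary.
have psieta : ip psi eta = t by rewrite -H1xi ip_unitary.
have [l2 [nl2 H2eta H2fix]] := householder (etrans eta1 (esym e1)).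
set H2 := reflection _ _ in H2eta H2fix.
have uH2 : H2 \is unitarymx by apply: reflection_unitary.
(* Both [eta] and [e] have inner product t with [psi], so [psi] is orthogonal to the reflection
   vector eta - e. *)
have H2psi : H2 *m psi = psi.
  apply: H2fix; rewrite ipBl ipZl ip_delta -/c omc ipC psieta.
  by rewrite (_ : t^* = t) ?subrr //; apply/CrealP/normr_real.
have uV : H2 *m H1 \is unitarymx by apply: mul_unitarymx.
exists (H2 *m H1) => // a az; move: uV.
have Vxi : H2 *m H1 *m xi = psi by rewrite -mulmxA H1xi.
have VXxi : H2 *m H1 *m (Xgate C d *m xi) = e by rewrite -mulmxA.
move: (H2 *m H1) Vxi VXxi => V Vxi VXxi uV.
have -> : phi = r *: (V *m xi) by rewrite Vxi scalerA mulfV // scale1r.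
rewrite -scalemxAr -!mulmxA (mulmxA (V^t*)) unitary_mulVmx // mul1mx VXxi.
by rewrite !mxE (negbTE az) !mulr0.
Qed.

End SingleQudit.

(** * State preparation with single controls *)

Section StatePreparation.
Variables (C : numClosedFieldType) (d m : nat) (z : 'I_d).
Hypothesis d1 : (1 < d)%N.
Implicit Types (x y : basis d m) (v w : 'cV[C]_(qdim d m)).
Implicit Types (W : 'M[C]_(qdim d m)).

(** The digits of [x] from position k on select a block of d^k basis vectors. [vanishes] says that v
    is zero on this block, [prepared] that only the vector with k leading digits z may survive
    there. *)
Definition agree k x y := forall j : 'I_m, (k <= j)%N -> y j = x j.

Definition vanishes k x v := forall y, agree k x y -> coef v y = 0.

Definition prepared k x v :=
  forall y, agree k x y -> ~~ low z k y -> coef v y = 0.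

Definition active (q : option ('I_m * 'I_d)) x :=
  if q is Some (i, b) then x i == b else true.

(** The control lies outside the k qudits being treated and never fires on z; [None] stands for no
    control. *)
Definition admissible k (q : option ('I_m * 'I_d)) :=
  if q is Some (i, b) then (k <= i)%N && (b != z) else true.

Definition prep_cost k := (\sum_(i < k) d ^ i - k)%N.

Lemma leq_sum_expn k : (k <= \sum_(i < k) d ^ i)%N.
Proof.
rewrite -[k in (k <= _)%N]card_ord -sum1_card; apply: leq_sum => i _.
by rewrite expn_gt0 ltnW.
Qed.

(** Mirrors the recursive circuit: d sub-blocks, of which the d - 1 with a digit other than z add a
    control to k otherwise uncontrolled operators. *)
Lemma prep_costS k : (prep_cost k.+1 = d * prep_cost k + d.-1 * k)%N.
Proof.
rewrite /prep_cost big_ord_recl expn0.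
under eq_bigr => i _ do rewrite expnS.
rewrite -big_distrr /=; have := leq_sum_expn k.
move: (\sum_(i < k) _)%N => s ks; case: d d1 => [//|e _] /=.
by rewrite -{1}(subnK ks); move: (s - k)%N => r; rewrite mulnDr; lia.
Qed.

Lemma agreeS (t : 'I_m) x y :
  agree t.+1 x y -> agree t (upd x t (y t)) y.
Proof.
move=> xy j; rewrite leq_eqVlt => /orP [/eqP tj|tj].
  by rewrite -(val_inj tj : t = j) upd_same.
by rewrite upd_neq ?xy // -(inj_eq val_inj) /= gtn_eqF.
Qed.

Lemma agree_upd (t : 'I_m) x y a :
  agree t.+1 x y -> agree t (upd x t a) (upd y t a).
Proof.
move=> xy j; rewrite leq_eqVlt => /orP [/eqP tj|tj].
  by rewrite -(val_inj tj : t = j) !upd_same.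
by rewrite !upd_neq ?xy // -(inj_eq val_inj) /= gtn_eqF.
Qed.

Lemma agree_updS (t : 'I_m) x y a : agree t (upd x t a) y -> agree t.+1 x y.
Proof.
by move=> h j tj; rewrite h 1?ltnW // upd_neq // -(inj_eq val_inj) /= gtn_eqF.
Qed.

Lemma vanishesS (t : 'I_m) x v :
  (forall a, vanishes t (upd x t a) v) <-> vanishes t.+1 x v.
Proof.
split=> [h y xy|h a y xy]; first exact/h/agreeS.
exact/h/agree_updS/xy.
Qed.

Lemma preparedS (t : 'I_m) x v :
  (prepared t (upd x t z) v /\
   forall a, a != z -> vanishes t (upd x t a) v) <-> prepared t.+1 x v.
Proof.
split=> [[hz ha] y xy|h].
  rewrite lowS negb_and; have [yz|yz] := eqVneq (y t) z.
    by rewrite orbF; apply: hz; rewrite -yz; apply: agreeS.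
  by move=> _; apply: (ha _ yz); apply: agreeS.
split=> [y xy ny|a az y xy]; apply: h; try exact/agree_updS/xy.
  by rewrite lowS negb_and ny.
by rewrite lowS negb_and (xy t) // upd_same az orbT.
Qed.

Lemma admissible_neq (t : 'I_m) i b :
  admissible t.+1 (Some (i, b)) -> i != t.
Proof. by case/andP => ti _; rewrite -(inj_eq val_inj) /= gtn_eqF. Qed.

Lemma admissible_indep (t : 'I_m) q : admissible t.+1 q -> indep (active q) t.
Proof. by case: q => [[i b]|] //= /admissible_neq it x a; rewrite /= upd_neq. Qed.

(** The coercion [q : bool] is the price: one CINC with a control, none without. *)
Lemma preparation_gate q (t : 'I_m) (phi : 'I_d -> C) : admissible t.+1 q ->
  exists A : 'M[C]_d, realizable (q : bool) (ctl_mx (active q) t A) /\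
    forall a, a != z -> \sum_b A a b * phi b = 0.
Proof.
move=> aq; have iq := admissible_indep aq.
have [V uV hV] := Xgate_conj_to_basis z (\col_b phi b) d1.
exists (V *m Xgate C d *m V^t*); split=> [|a /hV].
  case: q iq aq => [[i b]|] iq aq.
    by apply: realizable_conj => //; apply/realizable_ctlX/admissible_neq/aq.
  apply: realizable_local; rewrite !mul_unitarymx ?trmxC_unitary //.
  exact: Xgate_unitary.
by rewrite mxE; under eq_bigr => b _ do rewrite [(\col__ _) _ _]mxE.
Qed.

(* Once the block of x is prepared, every later gate is controlled on a digit
   different from z and leaves it alone, so one control suffices throughout. *)
Lemma state_preparation k q x v : (k <= m)%N -> admissible k q -> active q x ->
  exists W, [/\ realizable (prep_cost k + (q : bool) * k) W,
    forall x' u, vanishes k x' u -> vanishes k x' (W *m u),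
    forall x' u, ~~ active q x' -> prepared k x' u -> prepared k x' (W *m u)
    & prepared k x (W *m v)].
Proof.
elim: k q x v => [|k IH] q x v km aq qx.
  exists 1%:M; split=> [|x' u|x' u _|]; rewrite ?mul1mx //.
    by apply: realizable_le (realizable1 C d m).
  by move=> y _; rewrite low0.
pose t := Ordinal km.
have iq : indep (active q) t by apply: admissible_indep.
have aq' : admissible k q by case: q aq {qx iq} => [[i b]|] //= /andP [/ltnW -> ->].
(* The sub-block of digit z comes first: its circuit may act on all sub-blocks, whereas the later
   ones, controlled on a digit of [t] other than z, preserve its prepared form. *)
have [Wz [rWz Wzv Wzp Wzx]] := IH q (upd x t z) v (ltnW km) aq' (etrans (iq _ _) qx).
have others (s : seq 'I_d) : all (fun a => a != z) s ->
    exists W, [/\ realizable (size s * (prep_cost k + k)) W,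
      forall x' u, vanishes k x' u -> vanishes k x' (W *m u),
      forall x' u, x' t = z -> prepared k x' u -> prepared k x' (W *m u)
      & forall a, a \in s -> prepared k (upd x t a) (W *m (Wz *m v))].
  elim: s => [_|a s IHs /= /andP [az /IHs [W [rW Wv Wp Wx]]]].
    by exists 1%:M; split=> [|x' u|x' u|//]; rewrite ?mul1mx //; apply: realizable1.
  have at_t : active (Some (t, a)) (upd x t a) by rewrite /= upd_same.
  have ad_t : admissible k (Some (t, a)) by rewrite /= leqnn.
  have [W' [rW' W'v W'p W'x]] := IH _ _ (W *m (Wz *m v)) (ltnW km) ad_t at_t.
  exists (W' *m W); split=> [|x' u h|x' u xz h|b].
  - by rewrite /= mul1n in rW'; rewrite mulSn; apply: realizableM.
  - by rewrite -mulmxA; apply/W'v/Wv.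
  - rewrite -mulmxA; apply: W'p; last exact: Wp.
    by rewrite /= xz eq_sym.
  rewrite inE -mulmxA; have [->//|ba] := eqVneq b a.
  by move=> /= bs; apply: W'p; [rewrite /= upd_same | apply: Wx].
pose s := [seq a <- enum 'I_d | a != z].
have sz : size s = d.-1.
  rewrite /s size_filter -[d in RHS](size_enum_ord d) -(count_predC (pred1 z)).
  rewrite (_ : count (pred1 z) _ = 1%N) //.
  by rewrite count_uniq_mem ?enum_uniq // mem_enum.
have [W [rW Wv Wp Wx]] := others s (filter_all _ _).
(* The one basis vector of sub-block [a] that may survive. These d coefficients form the one-qudit
   vector that the last gate sends to a multiple of |z>. *)
pose base a : basis d m := [ffun j : 'I_m => if (j < k)%N then z else upd x t a j].
have [A [rA A0]] :=
  preparation_gate (fun b => coef (W *m (Wz *m v)) (base b)) (aq : admissible t.+1 q).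
have Bp a : prepared k (upd x t a) (W *m (Wz *m v)).
  have [->|az] := eqVneq a z; first by apply: Wp; rewrite ?upd_same.
  by apply: Wx; rewrite mem_filter az mem_enum.
have gate_agree y y' : agree k.+1 y y' -> active q y' = active q y.
  by case: q aq {qx iq aq' Wzp rWz rA} => [[i b]|] //= /andP [ki _] ->.
exists (ctl_mx (active q) t A *m (W *m Wz)); split.
- apply: realizable_le (realizableM rA (realizableM rW rWz)).
  rewrite sz prep_costS -[X in (X * prep_cost k)%N](ltn_predK d1) mulSn mulnDr.
  by case: (q : bool); lia.
- move=> x' u /(vanishesS t) h.
  have {}h : vanishes k.+1 x' (W *m (Wz *m u)).
    by apply/(vanishesS t) => a; apply/Wv/Wzv/h.
  rewrite -!mulmxA => y xy; rewrite coef_ctl //; case: ifP => _; last exact: h.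
  rewrite big1 // => b _; rewrite h ?mulr0 //.
  exact: (@agree_updS t _ _ b (@agree_upd t _ _ b xy)).
(* Where [q] is off, the subcircuits controlled on [t] may still fire, but only on sub-blocks where
   u vanishes, which they keep zero. *)
- move=> x' u nq /(preparedS t) [hz ha].
  rewrite -!mulmxA => y xy ny; rewrite coef_ctlF ?(gate_agree _ _ xy) //.
  move: y xy ny; apply/(preparedS t); split=> [|a az].
    by apply: Wp; rewrite ?upd_same //; apply: Wzp => //; rewrite iq.
  exact/Wv/Wzv/ha.
rewrite -!mulmxA => y xy ny; rewrite coef_ctlT ?(gate_agree _ _ xy) // coef_ctl //=.
have [ly|nly] := boolP (low z k y); last first.
  rewrite big1 // => b _; rewrite (Bp b) ?mulr0 //; first exact: (@agree_upd t).
  by rewrite (low_upd _ _ _ (leqnn t)).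
rewrite -[RHS](A0 (y t)); last by apply: contra ny => yz; rewrite (lowS z t) yz andbT.
apply: eq_bigr => b _; congr (_ * coef _ _).
apply/ffunP => j; rewrite [RHS]ffunE; case: ltnP => jk.
  rewrite upd_neq ?(eqP (implyP (forallP ly j) jk)) //.
  by rewrite -(inj_eq val_inj) /= ltn_eqF.
exact: (@agree_upd t _ _ b xy).
Qed.

End StatePreparation.

(** * Circuits for reflections and completion of the columns *)

Section Isometries.
Variables (C : numClosedFieldType) (d m : nat) (z : 'I_d).
Hypothesis d1 : (1 < d)%N.

Definition reflection_cost := (prep_cost d m + (2 * (2 ^ m - 1 - m) + prep_cost d m))%N.

Lemma realizable_reflection (w : 'cV[C]_(qdim d m)) l : (0 < m)%N -> `|l| = 1 ->
  realizable reflection_cost (reflection w l).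
Proof.
move=> m0 nl; have [->|w0] := eqVneq w 0.
  rewrite /reflection mul0mx scaler0 subr0.
  exact: realizable_le (realizable1 C d m).
pose zs : basis d m := [ffun=> z].
have [W [rW _ _ hW]] := @state_preparation C d m z d1 m None zs w (leqnn m) isT isT.
rewrite mul0n addn0 in rW; have uW := realizable_unitary rW.
have {}hW y : y != zs -> coef (W *m w) y = 0.
  move=> yz; apply: hW => [j|]; first by rewrite leqNgt ltn_ord.
  apply: contra yz => /forallP h; apply/eqP/ffunP => k; rewrite ffunE.
  by apply/eqP; apply: (implyP (h k)); apply: ltn_ord.
have lowE y : low z m y = (y == zs).
  apply/forallP/eqP => [h|-> k]; last by rewrite ffunE eqxx implybT.
  by apply/ffunP => k; rewrite ffunE; apply/eqP/(implyP (h k)).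
pose al := coef (W *m w) zs.
(* Since W w = al |z...z>, inner products with w are read off a single coefficient. *)
have ipW v : ip w v = al^* * coef (W *m v) zs.
  rewrite -(ip_unitary _ _ uW) ipE (bigD1 (enum_rank zs)) //= big1 ?addr0 // => r rz.
  rewrite (_ : (W *m w) r 0 = 0) ?conjC0 ?mul0r // -[r]enum_valK.
  by apply: hW; rewrite -(inj_eq enum_rank_inj) enum_valK.
have s0 : ip w w != 0 by rewrite ip_eq0.
have -> : reflection w l = W^t* *m (low_phase m z m l *m W).
  have : W *m reflection w l = low_phase m z m l *m W.
    apply: mx_coef_ext => v y; rewrite -!mulmxA reflection_mul mulmxBr -scalemxAr.
    have coefBZ c a b : coef (a - c *: b) y = coef a y - c * coef b y.
      by rewrite /coef !mxE.
    rewrite coefBZ coef_dg lowE !ipW.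
    have [->|yz] := eqVneq y zs; last by rewrite (hW y) // mulr0 subr0 mul1r.
    have := s0; rewrite ipW -/al; move: (coef _ _) => b ab.
    by field; move: ab; rewrite mulf_eq0 negb_or andbC.
  by move=> <-; rewrite mulmxA unitary_mulVmx // mul1mx.
apply: realizableM (realizable_adj rW) (realizableM _ rW).
exact: realizable_low_phase.
Qed.

Lemma ip_col n (T : 'M[C]_(qdim d m, n)) i j : T^t* *m T = 1%:M ->
  ip (col i T) (col j T) = (i == j)%:R.
Proof.
move=> /matrixP /(_ i j); rewrite !mxE => <-; rewrite ipE.
by apply: eq_bigr => k _; rewrite !mxE.
Qed.

Lemma realizable_isometry n (T V : 'M[C]_(qdim d m, n)) : (0 < m)%N ->
  T^t* *m T = 1%:M -> V^t* *m V = 1%:M ->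
  exists2 U, realizable (n * reflection_cost) U & U *m T = V.
Proof.
move=> m0 uT uV.
suff /(_ n (leqnn n)) [U rU hU] : forall k, (k <= n)%N ->
    exists2 U : 'M[C]_(qdim d m), realizable (k * reflection_cost) U
      & forall j : 'I_n, (j < k)%N -> U *m col j T = col j V.
  exists U => //; apply/matrixP => r c.
  have /matrixP/(_ r 0) := hU c (ltn_ord c).
  by rewrite !colE mulmxA -!colE !mxE.
elim=> [_|k IH kn]; first by exists 1%:M => //; apply: realizable1.
have [U rU hU] := IH (ltnW kn); have uU := realizable_unitary rU.
pose i := Ordinal kn.
have nuv : ip (U *m col i T) (U *m col i T) = ip (col i V) (col i V).
  by rewrite ip_unitary // !ip_col.
have [l [nl Hi Hfix]] := householder nuv.
exists (reflection (U *m col i T - col i V) l *m U) => [|j].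
  by rewrite mulSn; apply: realizableM (realizable_reflection _ m0 nl) rU.
rewrite ltnS leq_eqVlt -mulmxA => /orP [/eqP ji|jk].
  by rewrite (val_inj (ji : val j = val i)).
(* For j < k, column j of V is the image under U of column j of T. As T and V both have orthonormal
   columns, it is orthogonal to the reflection vector. *)
rewrite (hU j) //; apply: Hfix; rewrite ipBl -{1}(hU _ jk) ip_unitary // !ip_col //.
by rewrite subrr.
Qed.

End Isometries.

(** * The ancilla embedding *)

Section Ancillas.
Variables (C : numClosedFieldType) (d p q m : nat) (e : (p + q)%N = m).
Implicit Types (x : basis d m).

Definition left_digits x : basis d p := [ffun k => x (cast_ord e (lshift q k))].

Definition right_digits x : basis d q := [ffun k => x (cast_ord e (rshift p k))].

Lemma digits_inj x x' : left_digits x = left_digits x' ->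
  right_digits x = right_digits x' -> x = x'.
Proof.
move=> /ffunP hl /ffunP hr; apply/ffunP => k.
rewrite -[k](cast_ordKV e) -[cast_ord _ k]splitK.
by case: split => i; [have := hl i | have := hr i]; rewrite !ffunE.
Qed.

Lemma digits_surj y y' : exists x, left_digits x = y /\ right_digits x = y'.
Proof.
pose f k := match split (cast_ord (esym e) k) with inl i => y i | inr i => y' i end.
exists [ffun k => f k]; split; apply/ffunP => k; rewrite !ffunE /f cast_ordK.
  by case: splitP => i /= ki; [congr (y _); apply: val_inj | have := ltn_ord k; lia].
case: splitP => i /= ki; first by have := ltn_ord i; lia.
by congr (y' _); apply: val_inj => /=; lia.
Qed.

(** The map psi -> |0...0> (x) psi as a matrix T, so that a circuit U implements V exactly when U T
    = V. *)
Definition embed_mx : 'M[C]_(qdim d m, qdim d q) :=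
  \matrix_(r, c) tensor e (ket0 C d p) (delta_mx c 0) r 0.

Lemma embed_mxE r c : embed_mx r c =
  ket0 C d p (enum_rank (left_digits (enum_val r))) 0
    * (right_digits (enum_val r) == enum_val c)%:R.
Proof.
rewrite mxE [LHS]mxE /= [delta_mx _ _ _ _]mxE andbT -[X in _ == X]enum_valK.
by rewrite (inj_eq enum_rank_inj).
Qed.

Lemma tensor_ket0 psi : tensor e (ket0 C d p) psi = embed_mx *m psi.
Proof.
apply/matrixP => r c; rewrite (ord1 c) [LHS]mxE [RHS]mxE /=.
rewrite (bigD1 (enum_rank (right_digits (enum_val r)))) //= embed_mxE.
rewrite enum_rankK eqxx mulr1 big1 ?addr0 // => k /eqP kr.
rewrite embed_mxE; case: eqP => [h|_]; last by rewrite mulr0 mul0r.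
by case: kr; rewrite h enum_valK.
Qed.

Lemma embed_mx_isometry (z : 'I_d) : val z = 0%N -> embed_mx^t* *m embed_mx = 1%:M.
Proof.
move=> z0.
have ketE y : ket0 C d p (enum_rank y) 0 = (y == [ffun=> z])%:R.
  rewrite mxE enum_rankK; congr (nat_of_bool _)%:R; apply/forallP/eqP => [h|-> k].
    by apply/ffunP => k; rewrite ffunE; apply/val_inj/eqP; rewrite /= z0.
  by rewrite ffunE z0.
apply/matrixP => i j; rewrite mxE mxE.
have [x [xl xr]] := digits_surj [ffun=> z] (enum_val i).
have adjE k : (embed_mx^t*) i k = (embed_mx k i)^* by rewrite !mxE.
rewrite (bigD1 (enum_rank x)) //= adjE !embed_mxE enum_rankK ketE xl eqxx xr eqxx.
rewrite !mul1r conjC1 mul1r (inj_eq enum_val_inj) big1 ?addr0 // => k kx.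
rewrite adjE embed_mxE ketE; case: eqP => [hl|_]; last by rewrite mul0r conjC0 mul0r.
case: eqP => [hr|_]; last by rewrite mulr0 conjC0 mul0r.
case/eqP: kx; rewrite -[k]enum_valK; congr enum_rank.
by apply: digits_inj; rewrite ?hl ?hr ?xl ?xr.
Qed.

End Ancillas.

(** * The CINC count and the conclusion *)

Lemma card_basis d n : #|{: basis d n}| = (d ^ n)%N.
Proof. by rewrite card_ffun !card_ord. Qed.

(** With S the sum of d^i for i < m, one reflection costs 2 (S - m) + 2 (2^m - 1 - m). As 2^m - 1 is
    the sum of the 2^i, it is at most S, and the cost is at most 4 (S - m). *)
Lemma reflection_cost_le d n m : (1 < d)%N ->
  (d ^ n * reflection_cost d m <= Ncinc d n m)%N.
Proof.
move=> d1; rewrite /Ncinc /reflection_cost /prep_cost.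
have -> : ((d ^ m - 1) %/ (d - 1) = \sum_(i < m) d ^ i)%N.
  by rewrite !subn1 predn_exp mulKn // -subn1 subn_gt0.
have h : (2 ^ m - 1 <= \sum_(i < m) d ^ i)%N.
  rewrite subn1 predn_exp mul1n; apply: leq_sum => i _.
  by case: (posnP i) => [->|i0]; rewrite ?expn0 ?leq_exp2r.
apply: leq_trans (leq_addr _ _); rewrite [(4 * _)%N]mulnC -mulnA leq_mul2l.
by apply/orP; right; lia.
Qed.

Local Open Scope complex_scope.

Theorem theoremV3 (R : realType) (d n m : nat)
  (hd : (2 <= d)%N) (hn : (1 <= n)%N) (hnm : (n <= m)%N)
  (V : 'M[R[i]]_(qdim d m, qdim d n)) (hV : isometry_mx V) :
  exists c : circuit R[i] d m,
    implements hnm c V /\ (cinc_count c <= Ncinc d n m)%N.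
Proof.
have m0 : (0 < m)%N := leq_trans hn hnm.
pose z : 'I_d := Ordinal (ltnW hd).
have hT := embed_mx_isometry R[i] (subnK hnm) (erefl : val z = 0%N).
have [U [c [cU cN]] UT] := realizable_isometry z hd m0 hT hV.
exists c; split=> [psi|]; first by rewrite tensor_ket0 mulmxA cU UT.
by apply: leq_trans cN _; rewrite card_basis reflection_cost_le.
Qed.
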